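(* Let $C$ be a bounded convex subset of a Hilbert space and let $T:C\to C$ be non-expansive. Then the iteration $$\begin{aligned} y^{k+1}&=(I-\mu M)x^k,\\ x^{k+1}&=y^{k+1}+\tfrac{k}{k+2}(y^{k+1}-y^k)-\tfrac{k}{k+2}(y^k-x^{k-1})\end{aligned}\qquad(k\ge0),$$ started from $x^0=y^0=x^{-1}\in C$ and applied to the $\frac12$-cocoercive operator $M=I-T$ with $\mu=\frac12$, coincides with the classical Halpern iteration $$x^n=\frac{1}{n+1}x^0+\frac{n}{n+1}Tx^{n-1}\qquad(n\ge1).$$
   Context: $T:C\to C$ is non-expansive if $\|Tx-Ty\|\le\|x-y\|$ for all $x,y\in C$. An operator $M$ is cocoercive with parameter $\mu$ if $\langle Mx-My,x-y\rangle\ge\mu\|Mx-My\|^2$ for all $x,y$ in its domain; in a Hilbert space $M=I-T$ is $\frac12$-cocoercive when $T$ is non-expansive. $I$ denotes the identity. *)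

(* Defs.v *)
From HB Require Import structures.
From mathcomp Require Import all_boot all_order all_algebra sesquilinear.
From mathcomp Require Import all_classical all_reals all_analysis.

Set Implicit Arguments.
Unset Strict Implicit.
Unset Printing Implicit Defensive.

Import Order.TTheory GRing.Theory Num.Theory.
Import numFieldNormedType.Exports.

Local Open Scope classical_set_scope.
Local Open Scope ring_scope.

(* A real Hilbert space is a complete normed space V together with a
   symmetric positive definite form that induces its norm. *)
Definition hilbert_dot (R : realType) (V : completeNormedModType R)
    (dot : {dot V for idfun}) : Prop :=
  forall u : V, dot u u = `|u| ^+ 2.

Definition nonexpansive_on (R : realType) (V : normedModType R)
    (C : set V) (T : V -> V) : Prop :=
  forall x y, C x -> C y -> `|T x - T y| <= `|x - y|.

(* C is the domain of M; the values of M outside C are irrelevant. *)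
Definition cocoercive_on (R : realType) (V : completeNormedModType R)
    (dot : {dot V for idfun}) (C : set V) (mu : R) (M : V -> V) : Prop :=
  forall x y, C x -> C y ->
    dot (M x - M y) (x - y) >= mu * `|M x - M y| ^+ 2.

(* x is indexed by int because the recursion for k = 0 mentions x (-1);
   no x j with j < -1 is involved. *)
Definition accelerated_iteration (R : realType) (V : lmodType R)
    (mu : R) (M : V -> V) (x : int -> V) (y : nat -> V) : Prop :=
  forall k : nat,
    y k.+1 = x k%:Z - mu *: M (x k%:Z) /\
    x k.+1%:Z = y k.+1 + (k%:R / k.+2%:R) *: (y k.+1 - y k)
                       - (k%:R / k.+2%:R) *: (y k - x (k%:Z - 1)).

Definition halpern_iteration (R : realType) (V : lmodType R)
    (T : V -> V) (x : int -> V) : Prop :=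
  forall n : nat, (1 <= n)%N ->
    x n%:Z = (1 / n.+1%:R) *: x 0 + (n%:R / n.+1%:R) *: T (x (n%:Z - 1)).

(* Main.v *)
Require Import Defs.
From HB Require Import structures.
From mathcomp Require Import all_boot all_order all_algebra sesquilinear.
From mathcomp Require Import all_classical all_reals all_analysis.
From mathcomp Require Import ring lra.
Import Order.TTheory GRing.Theory Num.Theory.
Import numFieldNormedType.Exports.
Local Open Scope classical_set_scope.
Local Open Scope ring_scope.

(** Both parts are elementary once the right quantity is isolated.

    For cocoercivity, put d = x - y and m = Mx - My, so that Tx - Ty = d - m.
    Expanding |d - m|^2 <= |d|^2 through the scalar product gives
    |m|^2 <= 2 <m, d>, which is the claim.

    For the iterations, y^{k+1} = (x^k + T x^k) / 2 is the midpoint of x^k and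
    T x^k, so the reflected point 2 y^{k+1} - x^k is exactly T x^k.  The
    Halpern recursion can hence be rewritten without mentioning T, as
      x^k = x^0 / (k+1) + k / (k+1) (2 y^k - x^{k-1}),
    an identity which also makes sense, and is trivially true, at k = 0.
    The two momentum terms add up to k/(k+2) times
    y^{k+1} - (2 y^k - x^{k-1}), and the weight k/(k+2) is the one for
    which this reflected form of x^k makes the reflected point drop out of
    x^{k+1}, leaving precisely the next Halpern iterate
    ([accelerated_step_halpern]).  Both directions of the equivalence are
    inductions, or direct instances, of this single step.

    Finally Halpern iterates stay in C because each one is a convex combination
    of x^0 and of a value of T. *)

Lemma cocoercive_id_sub (R : realType) (V : completeNormedModType R)
    (dot : {dot V for idfun}) (C : set V) (T : V -> V) :
  hilbert_dot dot -> nonexpansive_on C T ->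
  cocoercive_on dot C (1 / 2) (fun u => u - T u).
Proof.
move=> hdot hT x y Cx Cy /=.
set d := x - y; set m := x - T x - (y - T y).
have dmE : T x - T y = d - m.
  have -> : m = d - (T x - T y) by rewrite /m /d !opprD !opprK addrACA.
  by rewrite subKr.
have : `|d - m| ^+ 2 <= `|d| ^+ 2.
  by rewrite -dmE lerXn2r ?nnegrE//; exact: hT.
clearbody d m.
rewrite -!hdot (hnormB (theta := idfun)) (hermC (theta := idfun) dot d m).
rewrite !expr0 !mul1r /=.
lra.
Qed.

Lemma reflect_midpoint (R : numFieldType) (V : lmodType R) (u v : V) :
  let y := u - (1 / 2 : R) *: (u - v) in y + y - u = v.
Proof.
rewrite /= addrACA -opprD -scalerDl.
have -> : (1 / 2 + 1 / 2 : R) = 1 by field.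
by rewrite scale1r addrAC addrK opprB addrC subrK.
Qed.

(** Here [q], [w] and [v] are y^k, x^{k-1} and T x^k.  The hypothesis is the
    Halpern recursion for x^k with T x^{k-1} replaced by the reflected point
    [q + q - w], which lets the step start at k = 0. *)
Lemma accelerated_step_halpern (R : numFieldType) (V : lmodType R)
    (k : nat) (x0 x q w v : V) :
  x = (1 / k.+1%:R : R) *: x0 + (k%:R / k.+1%:R : R) *: (q + q - w) ->
  let y := x - (1 / 2 : R) *: (x - v) in
  let c : R := k%:R / k.+2%:R in
  y + c *: (y - q) - c *: (q - w)
    = (1 / k.+2%:R : R) *: x0 + (k.+1%:R / k.+2%:R : R) *: v.
Proof.
move=> xE y c; set z := q + q - w in xE.
set s : R := k.+1%:R / k.+2%:R.
(* y is the midpoint (x + v) / 2, and 1 + k/(k+2) = 2 (k+1)/(k+2). *)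
have yE : (1 + c) *: y = s *: x + s *: v.
  have -> : 1 + c = s + s by rewrite /c /s; field.
  have /(canRL (subrK x)) yy := reflect_midpoint R V x v.
  by rewrite scalerDl -!scalerDr yy addrC.
have -> : y + c *: (y - q) - c *: (q - w) = (1 + c) *: y - c *: z.
  rewrite -addrA -scalerBr scalerDl scale1r -[RHS]addrA -scalerBr.
  by rewrite /z !opprD opprK !addrA.
(* s times the weights of xE are 1/(k+2) and k/(k+2) = c. *)
rewrite yE {1}xE scalerDr !scalerA.
have -> : s * (1 / k.+1%:R) = 1 / k.+2%:R by rewrite /s; field; rewrite -natrD nat1r !pnatr_eq0.
have -> : s * (k%:R / k.+1%:R) = c by rewrite /s /c; field; rewrite -natrD nat1r !pnatr_eq0.
by rewrite addrAC addrK.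
Qed.

Lemma intS_sub1 (k : nat) : k.+1%:Z - 1 = k%:Z.
Proof. by rewrite intS addrC addKr. Qed.

Lemma halpern_iterationS (R : realType) (V : lmodType R) (T : V -> V)
    (x : int -> V) :
  halpern_iteration T x <->
  forall k : nat, x k.+1%:Z =
    (1 / k.+2%:R : R) *: x 0 + (k.+1%:R / k.+2%:R : R) *: T (x k%:Z).
Proof.
split=> [H k|H [//|k] _]; first by rewrite H// intS_sub1.
by rewrite H intS_sub1.
Qed.

Lemma accelerated_halpern (R : realType) (V : lmodType R) (T : V -> V)
    (x : int -> V) :
  (exists y : nat -> V,
      y 0%N = x 0 /\ accelerated_iteration (1 / 2) (fun u => u - T u) x y) <->
  halpern_iteration T x.
Proof.
rewrite halpern_iterationS.
(* The T-free form of the recursion; it is the invariant of both directions. *)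
pose reflected (y : nat -> V) (k : nat) := x k%:Z =
  (1 / k.+1%:R : R) *: x 0
    + (k%:R / k.+1%:R : R) *: (y k + y k - x (k%:Z - 1)).
have reflected0 y : reflected y 0%N.
  by rewrite /reflected mul0r scale0r addr0 divr1 scale1r.
have reflectedS (y : nat -> V) (k : nat) :
    y k.+1 = x k%:Z - (1 / 2 : R) *: (x k%:Z - T (x k%:Z)) ->
    x k.+1%:Z =
      (1 / k.+2%:R : R) *: x 0 + (k.+1%:R / k.+2%:R : R) *: T (x k%:Z) ->
    reflected y k.+1.
  by rewrite /reflected intS_sub1 => -> ->; rewrite reflect_midpoint.
split=> [[y [_ yx]] k | H].
  have step j : reflected y j -> x j.+1%:Z =
      (1 / j.+2%:R : R) *: x 0 + (j.+1%:R / j.+2%:R : R) *: T (x j%:Z).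
    by have [yE ->] := yx j; rewrite yE; exact: accelerated_step_halpern.
  apply: (step); elim: k => [//|k IH].
  by apply: (reflectedS y k _ (step k IH)); have [] := yx k.
pose y (k : nat) : V := if k is j.+1 then
  x j%:Z - (1 / 2 : R) *: (x j%:Z - T (x j%:Z)) else x 0.
exists y; split=> // k; split=> //.
rewrite H; apply/esym/accelerated_step_halpern.
by case: k => [|k]; [exact: (reflected0 y) | exact: (reflectedS y)].
Qed.

Lemma halpern_in_convex (R : realType) (V : lmodType R) (C : set V)
    (T : {fun C >-> C}) (x : int -> V) :
  convex_set C -> C (x 0) -> halpern_iteration T x ->
  forall n : nat, C (x n%:Z).
Proof.
move=> hC C0 /halpern_iterationS H; elim=> [//|n IH]; rewrite H.
have t0 : (0 : R) <= 1 / n.+2%:R by rewrite divr_ge0.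
have t1 : (1 / n.+2%:R : R) <= 1 by rewrite ler_pdivrMr ?ltr0n// mul1r ler1n.
have -> : (n.+1%:R / n.+2%:R : R) = 1 - 1 / n.+2%:R by field.
have CT : C (T (x n%:Z)) by exact: funS.
have /set_mem := hC (x 0) (T (x n%:Z)) (Itv01 t0 t1) (mem_set C0) (mem_set CT).
exact.
Qed.

Theorem proposition4p3 (R : realType) (V : completeNormedModType R)
    (dot : {dot V for idfun}) (hdot : hilbert_dot dot)
    (C : set V) (hCb : bounded_set C)
    (hCc : convex_set C)
    (T : {fun C >-> C}) (hT : nonexpansive_on C T) :
  let M := fun u : V => u - T u in
  cocoercive_on dot C (1 / 2) M /\
  forall x : int -> V, C (x 0) -> x (-1) = x 0 ->
    ((exists y : nat -> V,
        y 0%N = x 0 /\ accelerated_iteration (1 / 2) M x y) <->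
     halpern_iteration T x) /\
    (halpern_iteration T x -> forall n : nat, C (x n%:Z)).
Proof.
move=> M; split; first exact: cocoercive_id_sub.
move=> x C0 _; split; first exact: accelerated_halpern.
exact: halpern_in_convex.
Qed.
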